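(* Let $1\le p<q\le2$, $K>1$ and $\tau>0$. Then there is a constant $c_{q,K}>0$, depending only on $K$ and $q$, such that $$\bar n^{\mathrm{wor}}(\varepsilon,\delta,\mathcal Y_{p,q,K}\cap\tau\mathcal B_q)\ \ge\ c_{q,K}\left(\frac\tau\varepsilon\right)^{1+1/(q-1)}\log\left(\tfrac43\delta\right)^{-1}$$ for any $0<\varepsilon\le\frac16(1-1/K)\,\tau$ and $0<\delta\le1/4$, where $\log\left(\tfrac43\delta\right)^{-1}$ denotes $\log\left(1/(\tfrac43\delta)\right)$.
   Context: Random variables are real-valued on a probability space $(\Omega,\Sigma,\mathbb P)$, assumed rich enough to carry all random variables considered (random variables with arbitrary distributions, sequences of i.i.d. copies, independent auxiliary randomness). $\|X\|_q=(\mathbb E|X|^q)^{1/q}$. For $1\le p<q\le2$, $K>1$, $\tau>0$, $$\mathcal Y_{p,q,K}:=\{Y\in L_q\mid \|Y-\mathbb E Y\|_q\le K\|Y-\mathbb E Y\|_p\},\qquad \tau\mathcal B_q:=\{Y\in L_q\mid\|Y-\mathbb E Y\|_q\le\tau\}.$$ An i.i.d.-based algorithm on a class $\mathcal Y$ of random variables consists of: an auxiliary random variable $U$ with values in a measurable space $(\mathbb U,\Sigma_U)$; a measurable $\phi:\mathbb U\times\mathbb R^{\mathbb N}\to\mathbb R$; and a measurable stopping rule $n:\mathbb U\times\mathbb R^{\mathbb N}\to\mathbb N_0\cup\{\infty\}$ such that whether $n(u,(y_j)_j)\ge i$ depends only on $(u,y_1,\dots,y_{i-1})$. For $Y\in\mathcal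 Y$ with i.i.d. copies $(Y_i)_{i\in\mathbb N}$, independent of $U$, put $n(\omega,Y):=n(U(\omega),(Y_i(\omega))_i)$, assumed almost surely finite for each $Y\in\mathcal Y$, and $A(\omega,Y):=\phi(U(\omega),Y_1(\omega),\dots,Y_{n(\omega,Y)}(\omega),0,0,\dots)$; $A(Y):=A(\cdot,Y)$. The algorithm is $(\varepsilon,\delta)$-approximating on $\mathcal Y$ if $\mathbb P\{|A(Y)-\mathbb E Y|\le\varepsilon\}\ge1-\delta$ for all $Y\in\mathcal Y$. The expected cost is $\bar n(A,Y):=\mathbb E\,n(\cdot,Y)$, the worst case cost is $\bar n^{\mathrm{wor}}(A,\mathcal Y):=\sup_{Y\in\mathcal Y}\bar n(A,Y)$, and the worst case complexity is $$\bar n^{\mathrm{wor}}(\varepsilon,\delta,\mathcal Y):=\inf\{n>0\mid\exists\ (\varepsilon,\delta)\text{-approximating i.i.d.-based } A\text{ on }\mathcal Y\text{ with }\bar n^{\mathrm{wor}}(A,\mathcal Y)\le n\}.$$ *)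

(* Defs.v *)
From HB Require Import structures.
From mathcomp Require Import all_boot all_order all_algebra finmap.
From mathcomp Require Import all_classical all_reals all_analysis.
Import Order.TTheory GRing.Theory Num.Theory.
Import numFieldNormedType.Exports.

Set Implicit Arguments.
Unset Strict Implicit.
Unset Printing Implicit Defensive.

Local Open Scope classical_set_scope.
Local Open Scope ring_scope.

(* The measurable space R^N: [nat -> R] with its product sigma-algebra. *)
Definition cylinders (R : realType) : set (set (nat -> R)) :=
  [set C | exists i (B : set R),
      measurable B /\ C = [set y | B (y i)]].

Definition realseq (R : realType) := g_sigma_algebraType (@cylinders R).

HB.instance Definition _ (R : realType) := Measurable.on (realseq R).

(* [option nat] is N_0 together with infinity, infinity being [None]. *)
Definition at_least (i : nat) (m : option nat) : bool :=
  if m is Some k then (i <= k)%N else true.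

Definition count_to_ereal (R : realType) (m : option nat) : \bar R :=
  if m is Some k then k%:R%:E else +oo%E.

(* The terms of rank >= m are replaced by 0; sequences are indexed from 0, so
   that y_1, y_2, ... are [y 0], [y 1], ... *)
Definition truncate (R : realType) (m : option nat) (y : realseq R) :
    realseq R :=
  fun j => if at_least j.+1 m then y j else 0.

Section random_variables.
Context d (T : measurableType d) (R : realType) (P : probability T R).

Definition carries_all_laws : Prop :=
  forall nu : probability R R,
  exists X : {RV P >-> R},
  forall B, measurable B -> distribution P X B = nu B.

Definition identically_distributed (X Y : {RV P >-> R}) : Prop :=
  forall B, measurable B -> distribution P X B = distribution P Y B.

Definition mutually_independent (Ys : nat -> {RV P >-> R}) : Prop :=
  forall (J : {fset nat}) (B : nat -> set R), (forall i, measurable (B i)) ->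
  P (\bigcap_(i in [set` J]) (Ys i @^-1` B i)) =
  (\prod_(i <- J) fine (P (Ys i @^-1` B i)))%:E.

Definition as_sequence (Ys : nat -> {RV P >-> R}) (w : T) : realseq R :=
  fun i => Ys i w.

Definition independent_of_sequence d' (V : measurableType d')
    (U : {mfun T >-> V}) (Ys : nat -> {RV P >-> R}) : Prop :=
  forall (A : set V) (C : set (realseq R)), measurable A -> measurable C ->
  P (U @^-1` A `&` as_sequence Ys @^-1` C) =
  (P (U @^-1` A) * P (as_sequence Ys @^-1` C))%E.

Definition iid_copies d' (V : measurableType d') (U : {mfun T >-> V})
    (Y : {RV P >-> R}) (Ys : nat -> {RV P >-> R}) : Prop :=
  [/\ forall i, identically_distributed (Ys i) Y,
      mutually_independent Ys & independent_of_sequence U Ys].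

Definition mean (Y : {RV P >-> R}) : R := fine 'E_P[Y].

Definition central_norm (q : R) (Y : {RV P >-> R}) : \bar R :=
  'N[P]_q%:E[(fun w => (Y w - mean Y)%:E)]%E.

Definition cone_class (p q K : R) : set {RV P >-> R} :=
  [set Y : {RV P >-> R} | (Y : T -> R) \in Lfun P q%:E /\
           (central_norm q Y <= K%:E * central_norm p Y)%E].

Definition central_ball (tau q : R) : set {RV P >-> R} :=
  [set Y : {RV P >-> R} | (Y : T -> R) \in Lfun P q%:E /\
                          (central_norm q Y <= tau%:E)%E].

(* An i.i.d.-based algorithm on the class [F].  As every random variable lives
   on the fixed probability space (T, P), the field [aux_leaves_room] expresses
   that T also carries i.i.d. copies, independent of the auxiliary randomness
   [aux], of each input; it excludes e.g. an [aux] that exhausts all the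
   randomness of T. *)
Record iid_algorithm (F : set {RV P >-> R}) := IidAlgorithm {
  aux_display : measure_display ;
  aux_space : measurableType aux_display ;
  aux : {mfun T >-> aux_space} ;
  out : aux_space * realseq R -> R ;
  stop : aux_space * realseq R -> option nat ;
  out_measurable : measurable_fun setT out ;
  stop_measurable : forall m, measurable (stop @^-1` [set m]) ;
  stop_nonanticipating : forall i u (y y' : realseq R),
    (forall j, (j.+1 < i)%N -> y j = y' j) ->
    at_least i (stop (u, y)) = at_least i (stop (u, y')) ;
  aux_leaves_room : forall Y, F Y -> exists Ys, iid_copies aux Y Ys ;
  stop_finite : forall Y Ys, F Y -> iid_copies aux Y Ys ->
    {ae P, forall w, stop (aux w, as_sequence Ys w) <> None}
}.

Arguments aux {F} _.
Arguments out {F} _ _.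
Arguments stop {F} _ _.

Section algorithm.
Context (F : set {RV P >-> R}) (A : iid_algorithm F).

Definition sample_count (Ys : nat -> {RV P >-> R}) (w : T) : option nat :=
  stop A (aux A w, as_sequence Ys w).

Definition output (Ys : nat -> {RV P >-> R}) (w : T) : R :=
  out A (aux A w, truncate (sample_count Ys w) (as_sequence Ys w)).

(* Error probability and expected cost depend only on the joint law of [aux]
   and the copies, hence not on which i.i.d. copies Ys of Y are taken. *)
Definition approximating (eps delta : R) : Prop :=
  forall Y Ys, F Y -> iid_copies (aux A) Y Ys ->
  ((1 - delta)%:E <= P [set w | `|output Ys w - mean Y| <= eps]%R)%E.

Definition expected_cost (Ys : nat -> {RV P >-> R}) : \bar R :=
  (\int[P]_w count_to_ereal R (sample_count Ys w))%E.

Definition worst_case_cost : \bar R :=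
  ereal_sup [set expected_cost Ys |
    Ys in [set Ys | exists2 Y, F Y & iid_copies (aux A) Y Ys]].

End algorithm.

Definition worst_case_complexity (eps delta : R) (F : set {RV P >-> R}) :
    \bar R :=
  ereal_inf [set n%:E | n in [set n : R | 0 < n /\
    exists A : iid_algorithm F,
      approximating A eps delta /\ (worst_case_cost A <= n%:E)%E]].

End random_variables.

Arguments carries_all_laws {d T R} P.
Arguments cone_class {d T R} P p q K _ /.
Arguments central_ball {d T R} P tau q _ /.

(* Main.v *)
Require Import Defs.
From HB Require Import structures.
From mathcomp Require Import all_boot all_order all_algebra finmap.
From mathcomp Require Import all_classical all_reals all_analysis.
From mathcomp Require Import measurable_realfun ring lra.
Import Order.TTheory GRing.Theory Num.Theory.
Import numFieldNormedType.Exports.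

Set Implicit Arguments.
Unset Strict Implicit.
Unset Printing Implicit Defensive.

Local Open Scope classical_set_scope.
Local Open Scope ring_scope.

(* Put kappa = 1 - 1/K.  Let Y0 take the values a and -a with mean -g, where
   g = 3 eps, and let the law of Y1 be (law Y0 + r delta_h) / (1 + r) with
   r = g / h, so that Y1 is centred.  For a = tau (1 - kappa / 2) and h of order
   tau (tau / eps)^(1/(q-1)) both variables belong to the class, and their means
   are more than 2 eps apart.

   An algorithm that stops after k samples sees, for every word in a and -a, the
   same data under Y1 as under Y0, with probability smaller by a factor (1 + r)^-k.
   With p_k the probability under Y0 of stopping after k samples with an output
   accurate for Y0, the sum of (1 + r)^-k p_k is at most delta, because such
   outputs are wrong for Y1, whereas the sum of p_k is at least 1 - delta and the
   sum of k p_k at most the expected cost.  By convexity the cost is at least of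
   order log(1 / delta) / r, and 1 / r is of order (tau / eps)^(1 + 1/(q-1)). *)

(** * Random variables with finitely supported laws *)

Section discrete_law.
Context {d} {T : measurableType d} {R : realType} (P : probability T R).
Variables (n : nat) (w x : nat -> R).
Hypothesis w_ge0 : forall i, 0 <= w i.

Definition discrete_measure : {measure set R -> \bar R} :=
  msum (fun i => mscale (NngNum (w_ge0 i)) \d_(x i)) n.

Lemma discrete_measureE (B : set R) :
  discrete_measure B = (\sum_(i < n) (w i)%:E * \d_(x i) B)%E.
Proof. by []. Qed.

Definition has_discrete_law (Y : {RV P >-> R}) : Prop :=
  forall B, measurable B -> distribution P Y B = discrete_measure B.

Lemma exists_discrete_law : carries_all_laws P -> \sum_(i < n) w i = 1 ->
  exists Y, has_discrete_law Y.
Proof.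
move=> carries sumw.
have nuT : discrete_measure setT = 1%E.
  rewrite discrete_measureE -[1%E]/(1%:E) -sumw -sumEFin.
  by apply: eq_bigr => i _; rewrite diracT mule1.
pose mu := msum (fun i => mscale (NngNum (w_ge0 i)) \d_(x i)) n.
pose nu : probability R R := HB.pack mu
  (Measure_isProbability.Build _ _ _ mu nuT).
have [Y YE] := carries nu.
by exists Y.
Qed.

Variable Y : {RV P >-> R}.
Hypothesis Ylaw : has_discrete_law Y.

(** Change of variables to the distribution, then a finite sum of Dirac integrals. Means and norms
    are both reduced to this nonnegative case. *)
Lemma ge0_integral_discrete_law (f : R -> \bar R) :
  measurable_fun setT f -> (forall y, 0 <= f y)%E ->
  (\int[P]_t f (Y t) = \sum_(i < n) (w i)%:E * f (x i))%E.
Proof.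
move=> mf f0; rewrite -(ge0_integral_distribution Y mf f0).
rewrite (eq_measure_integral discrete_measure); last by move=> A mA _; exact: Ylaw.
rewrite ge0_integral_measure_sum//; apply: eq_bigr => i _.
by rewrite ge0_integral_mscale// integral_dirac// diracT mul1e.
Qed.

Lemma mean_discrete_law : mean Y = \sum_(i < n) w i * x i.
Proof.
(* Positive and negative parts bring the expectation under the nonnegative formula. *)
rewrite /mean unlock integralE.
have mE := @EFin_measurable R setT.
rewrite (eq_integral (fun t => (EFin ^\+)%E (Y t))); last by move=> t _; rewrite !funeposE.
rewrite [X in (_ - X)%E](eq_integral (fun t => (EFin ^\-)%E (Y t))); last by move=> t _; rewrite !funenegE.
rewrite !ge0_integral_discrete_law//; [|exact: measurable_funeneg|exact: measurable_funepos].
rewrite (eq_bigr (fun i : 'I_n => (w i * Num.max (x i) 0)%:E)); last first.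
  by move=> i _; rewrite ?funeposE ?funenegE EFinM EFin_max.
rewrite [X in fine (_ - X)](eq_bigr (fun i : 'I_n => (w i * Num.max (- x i) 0)%:E)); last first.
  by move=> i _; rewrite ?funeposE ?funenegE EFinM EFin_max.
rewrite !sumEFin /= -sumrB; apply: eq_bigr => i _.
rewrite -mulrBr; congr (_ * _).
by case: (leP (x i) 0); case: (leP (- x i) 0); lra.
Qed.

Lemma Lnorm_discrete_law (r m : R) : 0 < r ->
  ('N[P]_r%:E[(fun t => (Y t - m)%:E)] =
   ((\sum_(i < n) w i * `|x i - m| `^ r) `^ r^-1)%:E)%E.
Proof.
move=> r0; rewrite unlock.
have mf : measurable_fun setT (fun y : R => (`|y - m| `^ r)%:E).
  apply/measurable_EFinP; apply: (measurableT_comp (measurable_powR _)) => //.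
  by apply: measurableT_comp => //; exact: measurable_funB.
rewrite (ge0_integral_discrete_law mf)//.
under eq_bigr do rewrite -EFinM.
by rewrite sumEFin.
Qed.

Lemma central_norm_discrete_law (r : R) : 0 < r ->
  central_norm r Y = ((\sum_(i < n) w i * `|x i - mean Y| `^ r) `^ r^-1)%:E.
Proof. exact: Lnorm_discrete_law. Qed.

Lemma discrete_law_Lfun (r : R) : 0 < r -> (Y : T -> R) \in Lfun P r%:E.
Proof.
move=> r0; rewrite inE; apply/andP; split; rewrite inE/=; first exact: measurable_funP.
rewrite /finite_norm (_ : EFin \o Y = fun t => (Y t - 0)%:E); last first.
  by apply/funext => t /=; rewrite subr0.
by rewrite Lnorm_discrete_law// ltry.
Qed.

End discrete_law.

(** * Sampling words *)

Section realseq_measurability.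
Context {R : realType}.

Lemma measurable_coordinate (i : nat) :
  measurable_fun setT (fun y : realseq R => y i).
Proof.
move=> _ B mB; rewrite setTI; apply: sub_sigma_algebra.
by exists i, B.
Qed.

Lemma measurable_fun_realseq d (T : measurableType d) (f : T -> realseq R) :
  (forall i, measurable_fun setT (fun t => f t i)) -> measurable_fun setT f.
Proof.
move=> mf; apply: (@measurability _ _ T (realseq R) setT f (@cylinders R)) => //.
move=> _ [_ [i [B [mB ->]]] <-].
exact: mf.
Qed.

Lemma measurable_truncate (m : option nat) :
  measurable_fun setT (@truncate R m).
Proof.
apply: measurable_fun_realseq => i; rewrite /truncate.
by case: (at_least i.+1 m); [exact: measurable_coordinate|exact: measurable_cst].
Qed.

End realseq_measurability.

Section words.
Context {R : realType} {I : finType} (v : I -> R).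

Definition word_cylinder k (s : {ffun 'I_k -> I}) : set (realseq R) :=
  [set y | forall j : 'I_k, y j = v (s j)].

(** A representative point of the cylinder, at which a prefix event can be sectioned. *)
Definition word_sequence k (s : {ffun 'I_k -> I}) : realseq R :=
  fun j => if insub j is Some i then v (s i) else 0.

Lemma word_cylinderE k (s : {ffun 'I_k -> I}) (y : realseq R) j :
  word_cylinder s y -> (j < k)%N -> y j = word_sequence s j.
Proof.
move=> sy jk; rewrite /word_sequence insubT.
exact: (sy (Ordinal jk)).
Qed.

Lemma measurable_word_cylinder k (s : {ffun 'I_k -> I}) :
  measurable (word_cylinder s).
Proof.
have -> : word_cylinder s =
    \bigcap_(j in [set: 'I_k]) ((fun y : realseq R => y j) @^-1` [set v (s j)]).
  by apply/seteqP; split => y sy j => [_|]; exact: sy.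
apply: fin_bigcap_measurable => [|j _]; first exact: finite_finset.
by rewrite -[X in measurable X]setTI; exact: measurable_coordinate.
Qed.

Lemma trivIset_word_cylinder k : injective v ->
  trivIset setT (@word_cylinder k).
Proof.
move=> v_inj s s' _ _ [y [sy s'y]]; apply/ffunP => j; apply: v_inj.
by rewrite -sy -s'y.
Qed.

End words.

Section iid_words.
Context {d} {T : measurableType d} {R : realType} {P : probability T R}.
Context {d'} {V : measurableType d'} (U : {mfun T >-> V}).

(** One implication is enough, since agreement on the first [k] samples is symmetric. *)
Definition prefix_event k (B : set (V * realseq R)) : Prop :=
  forall u (y y' : realseq R), (forall j, (j < k)%N -> y j = y' j) ->
  B (u, y) -> B (u, y').

Definition aux_and_samples (Ys : nat -> {RV P >-> R}) (t : T) : V * realseq R :=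
  (U t, as_sequence Ys t).

Lemma measurable_as_sequence (Ys : nat -> {RV P >-> R}) :
  measurable_fun setT (as_sequence Ys).
Proof. by apply: measurable_fun_realseq => i; exact: measurable_funP. Qed.

Lemma measurable_aux_and_samples (Ys : nat -> {RV P >-> R}) :
  measurable_fun setT (aux_and_samples Ys).
Proof. exact: measurable_fun_pair (measurable_as_sequence Ys). Qed.

Context {I : finType} (v : I -> R).

Lemma prob_word_cylinder (Y : {RV P >-> R}) (Ys : nat -> {RV P >-> R}) k
    (s : {ffun 'I_k -> I}) : iid_copies U Y Ys ->
  P (as_sequence Ys @^-1` word_cylinder v s) =
  (\prod_(j < k) fine (P (Y @^-1` [set v (s j)])))%:E.
Proof.
move=> [Yid Yind _].
(* [mutually_independent] asks for a set at every index; the indices beyond the word get the whole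
   line. *)
pose B (i : nat) := if insub i is Some j then [set v (s j)] else [set: R].
pose J := seq_fset tt (iota 0 k).
have -> : as_sequence Ys @^-1` word_cylinder v s =
    \bigcap_(i in [set` J]) (Ys i @^-1` B i).
  apply/seteqP; split => t /=.
  - move=> st i; rewrite /= seq_fsetE mem_iota add0n /= => ik.
    by rewrite /B insubT; exact: (st (Ordinal ik)).
  - move=> st j; have := st j.
    rewrite /= seq_fsetE mem_iota add0n /= => /(_ (ltn_ord j)).
    by rewrite /B valK.
rewrite Yind; last by move=> i; rewrite /B; case: insubP.
congr EFin; rewrite (perm_big (index_iota 0 k)); last first.
  by rewrite (perm_trans (seq_fset_perm _ _))// undup_id ?iota_uniq// /index_iota subn0.
rewrite big_mkord; apply: eq_bigr => j _; rewrite /B valK.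
by congr fine; exact: (Yid j).
Qed.

(** Within a word cylinder a prefix event constrains only [U], through its section at the
    representative sequence, so independence of [U] and the samples makes the probability a
    product. *)
Lemma prob_prefix_word (Y : {RV P >-> R}) (Ys : nat -> {RV P >-> R}) k
    (s : {ffun 'I_k -> I}) (B : set (V * realseq R)) :
  iid_copies U Y Ys -> measurable B -> prefix_event k B ->
  P (aux_and_samples Ys @^-1` B `&` as_sequence Ys @^-1` word_cylinder v s) =
  (P (U @^-1` ysection B (word_sequence v s)) *
   (\prod_(j < k) fine (P (Y @^-1` [set v (s j)])))%:E)%E.
Proof.
move=> iidY mB prefB; rewrite -(prob_word_cylinder s iidY).
have [_ _ <-] := iidY; [|exact: measurable_ysection|exact: measurable_word_cylinder].
congr (P _); apply/seteqP; split => t [] Bt st; split => //.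
- by apply/ysectionP; apply: prefB Bt => j jk; exact: word_cylinderE st jk.
- move/ysectionP: Bt; apply: prefB => j jk.
  by apply/esym; exact: word_cylinderE st jk.
Qed.

(* The samples of [Y0] almost surely form a word in the values of [v], and each word
   of length [k] loses at most a factor [t ^+ k] when passing from [Y0] to [Y1]. *)
Lemma prefix_event_domination (Y0 Y1 : {RV P >-> R})
    (Ys0 Ys1 : nat -> {RV P >-> R}) (t : R) k (B : set (V * realseq R)) :
  injective v -> iid_copies U Y0 Ys0 -> iid_copies U Y1 Ys1 -> 0 <= t ->
  (forall i, t * fine (P (Y0 @^-1` [set v i])) <= fine (P (Y1 @^-1` [set v i]))) ->
  P (Y0 @^-1` (~` range v)) = 0%E ->
  measurable B -> prefix_event k B ->
  ((t ^+ k)%:E * P (aux_and_samples Ys0 @^-1` B) <=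
   P (aux_and_samples Ys1 @^-1` B))%E.
Proof.
move=> v_inj iid0 iid1 t0 dom null mB prefB.
pose A Ys (s : {ffun 'I_k -> I}) :=
  aux_and_samples Ys @^-1` B `&` as_sequence Ys @^-1` word_cylinder v s.
have mE Ys : measurable (aux_and_samples Ys @^-1` B).
  by rewrite -[X in measurable X]setTI; exact: measurable_aux_and_samples.
have mA Ys s : measurable (A Ys s).
  apply: measurableI => //; rewrite -[X in measurable X]setTI.
  by apply: measurable_as_sequence => //; exact: measurable_word_cylinder.
have PA Ys : P (\bigcup_s A Ys s) = (\sum_(s \in [set: {ffun 'I_k -> I}]) P (A Ys s))%E.
  apply: measure_fin_bigcup => //; first exact: finite_finset.
  move=> s s' _ _ [x [[_ xs] [_ xs']]].
  by apply: (@trivIset_word_cylinder _ _ _ k v_inj) => //; exists (as_sequence Ys x).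
pose N := \bigcup_i (Ys0 i @^-1` (~` range v)).
have mrange : measurable (range v).
  have -> : range v = \bigcup_(i in [set: I]) [set v i].
    by apply/seteqP; split => [_ [i _ <-]|_ [i _ ->]]; exists i.
  by apply: fin_bigcup_measurable => [|i _]; [exact: finite_finset|exact: measurable_set1].
have mN i : measurable (Ys0 i @^-1` (~` range v)).
  by apply: measurable_funPTI; exact: measurableC.
have N0 : P N = 0%E.
  apply: measure_negligible; first exact: bigcup_measurable.
  apply: negligible_bigcup => i; apply/negligibleP => //.
  have [Yid _ _] := iid0.
  by rewrite -null; apply: Yid; exact: measurableC.
(* Outside the null set [N] the samples of [Y0] lie in some word cylinder. *)
apply: (@le_trans _ _ ((t ^+ k)%:E * P (\bigcup_s A Ys0 s)))%E.
  apply: lee_wpmul2l; first by rewrite lee_fin exprn_ge0.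
  rewrite -[X in (_ <= X)%E](measureU0 _ _ N0); last 2 first.
  - by apply: fin_bigcup_measurable; [exact: finite_finset|].
  - exact: bigcup_measurable.
  apply: le_measure; rewrite ?inE//.
    apply: measurableU; last exact: bigcup_measurable.
    by apply: fin_bigcup_measurable; [exact: finite_finset|].
  move=> x Bx; have [Nx|Nx] := pselect (N x); [by right|left].
  have /choice[s sE] (j : 'I_k) : exists i, v i = Ys0 j x.
    apply: contrapT => nj; apply: Nx; exists j => //= -[i _ vi].
    by apply: nj; exists i.
  exists [ffun j => s j] => //; split => // j.
  by rewrite ffunE sE.
(* Under [Y1] the words may cover only part of the event, which is enough for a lower bound. *)
apply: (@le_trans _ _ (P (\bigcup_s A Ys1 s))); last first.
  apply: le_measure; rewrite ?inE//; last by move=> x [s _ []].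
  by apply: fin_bigcup_measurable; [exact: finite_finset|].
rewrite !PA ge0_mule_fsumr//; apply: lee_fsum => [|s _]; first exact: finite_finset.
rewrite /A (prob_prefix_word _ iid0 mB prefB) (prob_prefix_word _ iid1 mB prefB).
rewrite muleCA; apply: lee_wpmul2l => //; rewrite -EFinM lee_fin.
rewrite -{1}(card_ord k) -prodr_const -big_split /=.
apply: ler_prod => j _; rewrite dom andbT mulr_ge0//.
exact: fine_ge0.
Qed.

End iid_words.

(** * Stopped algorithms *)

Lemma expR_opp_le_expr {R : realType} (r : R) k : 0 <= r ->
  expR (- (k%:R * r)) <= (1 + r)^-1 ^+ k.
Proof.
move=> r0; rewrite expRN expRM_natl -exprVn lerXn2r ?nnegrE ?invr_ge0 ?expR_ge0//.
  by rewrite addr_ge0.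
by rewrite lef_pV2 ?posrE ?expR_gt0 ?expR_ge1Dx// ltr_wpDr.
Qed.

(* The tangent of [x |-> expR (- (x * r))] at [x = 3/2 * E] replaces Jensen's inequality. *)
Lemma stopped_mass_bound {R : realType} (N : nat) (a : nat -> R) (r E delta : R) :
  (forall k, 0 <= a k) -> 0 <= r -> 0 < delta -> delta <= 1 / 4 ->
  2 / 3 <= \sum_(k < N) a k -> \sum_(k < N) k%:R * a k <= E ->
  \sum_(k < N) (1 + r)^-1 ^+ k * a k <= delta ->
  ln (1 / (4 / 3 * delta)) <= 3 * r * E.
Proof.
move=> a0 r0 d0 d4 S_ge E_ge D_le.
pose e := expR (- (3 / 2 * E * r)).
have E0 : 0 <= E.
  by apply: le_trans E_ge; apply: sumr_ge0 => k _; rewrite mulr_ge0.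
have e0 : 0 < e by exact: expR_gt0.
have tangent k : e * (1 + 3 / 2 * E * r - k%:R * r) <= (1 + r)^-1 ^+ k.
  apply: le_trans (expR_opp_le_expr k r0).
  rewrite [leRHS](_ : _ = e * expR (3 / 2 * E * r - k%:R * r)); last first.
    by rewrite -expRD; congr expR; ring.
  by rewrite ler_pM2l// -addrA expR_ge1Dx.
(* Weighting the tangents by [a k] gives at least [e * ((1 + 3 / 2 * E * r) * (2 / 3) - r * E)]; the
   base point [3 / 2 * E] is chosen so that the terms in [r * E] cancel. *)
have : e * (2 / 3) <= delta.
  apply: le_trans D_le.
  apply: (@le_trans _ _ (\sum_(k < N) e * (1 + 3 / 2 * E * r - k%:R * r) * a k)); last first.
    by apply: ler_sum => k _; apply: ler_wpM2r.
  rewrite (eq_bigr (fun k : 'I_N => e * (1 + 3 / 2 * E * r) * a k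
      - e * r * (k%:R * a k))); last by move=> k _; ring.
  rewrite sumrB -!mulr_sumr -!mulrA -mulrBr ler_pM2l//.
  have : (1 + 3 / 2 * E * r) * (2 / 3) <= (1 + 3 / 2 * E * r) * \sum_(k < N) a k.
    by rewrite ler_wpM2l// addr_ge0// !mulr_ge0.
  have : r * \sum_(k < N) k%:R * a k <= r * E by rewrite ler_wpM2l.
  lra.
move=> ed.
have dd : 0 < 4 / 3 * delta by lra.
rewrite -[leRHS]expRK ler_ln ?posrE ?expR_gt0 ?divr_gt0//.
rewrite [X in expR X](_ : _ = - (- (3 / 2 * E * r) + - (3 / 2 * E * r))); last by lra.
rewrite expRN expRD -/e div1r lef_pV2 ?posrE ?mulr_gt0//.
(* The bound [e <= 3 / 2 * delta] misses the target [4 / 3 * delta]; squaring, with [delta <= 1 / 4]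
   for one factor, yields [e * e <= 9 / 16 * delta] and doubles the exponent to [3 * r * E]. *)
have : (e * (2 / 3)) * (e * (2 / 3)) <= delta * (1 / 4).
  by apply: ler_pM => //; [lra|lra|exact: le_trans ed d4].
lra.
Qed.

Lemma measurable_comp_fibers d (T : measurableType d) (I : countType) S
    (h : T -> I) (g : I -> S) (B : set S) :
  (forall i, measurable (h @^-1` [set i])) -> measurable ((g \o h) @^-1` B).
Proof.
move=> mh; have -> : (g \o h) @^-1` B =
    \bigcup_i (if `[< B (g i) >] then h @^-1` [set i] else set0).
  apply/seteqP; split => [t Bt|t [i _]].
    by exists (h t) => //; rewrite asboolT.
  by case: asboolP => // Bi /= ->.
apply: countable_bigcupT_measurable => // i.
by case: asboolP.
Qed.

Section stopping.
Context {d} {T : measurableType d} {R : realType} {P : probability T R}.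
Context {F : set {RV P >-> R}} (A : iid_algorithm F).

Local Notation V := (aux_space A).
Local Notation outA := (@out _ _ _ _ _ A).
Local Notation stopA := (@stop _ _ _ _ _ A).

Lemma measurable_preimage_samples (Ys : nat -> {RV P >-> R}) (B : set (V * realseq R)) :
  measurable B -> measurable (aux_and_samples (aux A) Ys @^-1` B).
Proof.
move=> mB; rewrite -[X in measurable X]setTI.
exact: measurable_aux_and_samples.
Qed.

(** Fixing the stopping value turns the random truncation into the fixed measurable map
    [truncate m]. *)
Definition stopped_accurate (eps mu : R) (m : option nat) : set (V * realseq R) :=
  stopA @^-1` [set m] `&` [set z | `|outA (z.1, truncate m z.2) - mu| <= eps].

Lemma measurable_stopped_accurate eps mu m :
  measurable (stopped_accurate eps mu m).
Proof.
apply: measurableI; first exact: stop_measurable.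
have mg : measurable_fun setT
    (fun z : V * realseq R => `|outA (z.1, truncate m z.2) - mu|).
  apply: measurableT_comp => //; apply: measurable_funB => //.
  apply: (measurableT_comp (@out_measurable _ _ _ _ _ A)).
  apply: measurable_fun_pair => //.
  exact: (measurableT_comp (measurable_truncate m)).
have -> : [set z | `|outA (z.1, truncate m z.2) - mu| <= eps] =
    (fun z : V * realseq R => `|outA (z.1, truncate m z.2) - mu|) @^-1` `]-oo, eps]%classic.
  by apply/seteqP; split => z /=; rewrite in_itv.
by rewrite -[X in measurable X]setTI; exact: mg.
Qed.

(** Stopping at [k] means reaching [k] but not [k.+1]. The second condition is decided by the first
    [k] samples, the first by even fewer, and the output sees only these [k] samples. *)
Lemma prefix_stopped_accurate eps mu k :
  prefix_event k (stopped_accurate eps mu (Some k)).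
Proof.
move=> u y y' yy' [/= stopk acc]; split => /=.
- have le_stop : at_least k (stopA (u, y')) = at_least k (stopA (u, y)).
    by apply: (@stop_nonanticipating _ _ _ _ _ A) => j jk; rewrite yy'// ltnW.
  have lt_stop : at_least k.+1 (stopA (u, y')) = at_least k.+1 (stopA (u, y)).
    by apply: (@stop_nonanticipating _ _ _ _ _ A) => j jk; rewrite yy'.
  move: le_stop lt_stop; rewrite stopk /= leqnn ltnn.
  case: (stopA (u, y')) => [l|//] /= kl lk.
  by congr Some; apply/eqP; rewrite eqn_leq kl andbT leqNgt lk.
- rewrite (_ : truncate (Some k) y' = truncate (Some k) y)//.
  apply/funext => j; rewrite /truncate /=.
  by case: ifP => // jk; rewrite yy'.
Qed.

Definition accurate (Ys : nat -> {RV P >-> R}) (eps mu : R) : set T :=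
  [set w | `|output A Ys w - mu| <= eps].

Lemma accurateE Ys eps mu : accurate Ys eps mu =
  \bigcup_m (aux_and_samples (aux A) Ys @^-1` stopped_accurate eps mu m).
Proof.
apply/seteqP; split => [w acc|w [m _ [/= stopm acc]]].
  by exists (sample_count A Ys w).
by rewrite /accurate /= /output /sample_count stopm.
Qed.

Lemma measurable_accurate Ys eps mu : measurable (accurate Ys eps mu).
Proof.
rewrite accurateE; apply: countable_bigcupT_measurable => // m.
apply: measurable_preimage_samples; exact: measurable_stopped_accurate.
Qed.

Definition accurate_at (Ys : nat -> {RV P >-> R}) (eps mu : R) (k : nat) : set T :=
  aux_and_samples (aux A) Ys @^-1` stopped_accurate eps mu (Some k).

Lemma measurable_accurate_at Ys eps mu k : measurable (accurate_at Ys eps mu k).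
Proof. by apply: measurable_preimage_samples; exact: measurable_stopped_accurate. Qed.

Lemma trivIset_accurate_at Ys eps mu : trivIset setT (accurate_at Ys eps mu).
Proof. by move=> i j _ _ [w [[/= si _] [/= sj _]]]; move: sj; rewrite si => -[]. Qed.

Lemma accurate_at_sub Ys eps mu k : accurate_at Ys eps mu k `<=` accurate Ys eps mu.
Proof. by rewrite accurateE => w acc; exists (Some k). Qed.

Lemma measurable_sample_count (Ys : nat -> {RV P >-> R}) m :
  measurable (sample_count A Ys @^-1` [set m]).
Proof.
exact: (measurable_preimage_samples Ys (@stop_measurable _ _ _ _ _ A m)).
Qed.

(** The cost integral is restricted to finitely many disjoint events, on each of which the sample
    count is the constant [k]. *)
Lemma expected_cost_ge Ys eps mu N :
  ((\sum_(k < N) k%:R * fine (P (accurate_at Ys eps mu k)))%:E <=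
   expected_cost A Ys)%E.
Proof.
have mcount : measurable_fun setT (fun w => count_to_ereal R (sample_count A Ys w)).
  move=> _ B mB; rewrite setTI.
  apply: (@measurable_comp_fibers _ _ _ _ (sample_count A Ys)) => m.
  exact: measurable_sample_count.
have count_ge0 m : (0 <= count_to_ereal R m)%E by case: m => //= k; rewrite lee_fin.
have mD : measurable (\big[setU/set0]_(k <- iota 0 N) accurate_at Ys eps mu k).
  by apply: bigsetU_measurable => k _; exact: measurable_accurate_at.
rewrite /expected_cost.
apply: (@le_trans _ _ (\int[P]_(w in \big[setU/set0]_(k <- iota 0 N) accurate_at Ys eps mu k)
    count_to_ereal R (sample_count A Ys w))%E); last first.
  exact: ge0_subset_integral.
rewrite ge0_integral_bigsetU//; last 4 first.
- by move=> k; exact: measurable_accurate_at.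
- exact: iota_uniq.
- exact: sub_trivIset (@trivIset_accurate_at Ys eps mu).
- exact: measurable_funTS.
rewrite (_ : iota 0 N = index_iota 0 N); last by rewrite /index_iota subn0.
rewrite big_mkord -sumEFin; apply: lee_sum => k _.
rewrite (eq_integral (cst k%:R%:E)); last first.
  by move=> w /set_mem[/= sk _]; rewrite /sample_count -/(aux_and_samples _ _ _) sk.
rewrite integral_cst; last exact: measurable_accurate_at.
by rewrite EFinM fineK// fin_num_measure//; exact: measurable_accurate_at.
Qed.

(** Almost sure stopping discards the value [None], so the accurate events at finite [k] exhaust
    mass [1 - delta]; [eta] pays for keeping only finitely many of them. *)
Lemma accurate_at_mass (Y : {RV P >-> R}) Ys (eps delta eta : R) :
  F Y -> iid_copies (aux A) Y Ys -> approximating A eps delta -> 0 < eta ->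
  exists N, 1 - delta - eta <= \sum_(k < N) fine (P (accurate_at Ys eps (mean Y) k)).
Proof.
move=> FY iidY appr eta0; apply: contrapT => /forallNP small.
pose G := accurate_at Ys eps (mean Y).
have mG k : measurable (G k) by exact: measurable_accurate_at.
have PG_le : (P (\bigcup_k G k) <= (1 - delta - eta)%:E)%E.
  rewrite measure_semi_bigcup//; last 2 first.
  - exact: trivIset_accurate_at.
  - exact: bigcupT_measurable.
  apply: lime_le; first exact: is_cvg_nneseries.
  apply: nearW => N; rewrite big_mkord.
  rewrite (eq_bigr (fun k : 'I_N => (fine (P (G k)))%:E)); last first.
    by move=> k _; rewrite fineK// fin_num_measure.
  by rewrite sumEFin lee_fin; apply: ltW; rewrite ltNge; apply/negP; exact: small.
have : ((1 - delta)%:E <= P (\bigcup_k G k))%E.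
  apply: le_trans (appr _ _ FY iidY) _.
  have [M [mM M0 sub]] := stop_finite FY iidY.
  rewrite -(measureU0 (bigcupT_measurable G mG) mM M0).
  apply: le_measure; rewrite ?inE.
  - exact: measurable_accurate.
  - by apply: measurableU => //; exact: bigcupT_measurable.
  rewrite -/(accurate Ys eps (mean Y)) accurateE => w [[k|] _ acc]; first by left; exists k.
  by right; apply: sub => /=; apply; case: acc.
move=> /le_trans /(_ PG_le); rewrite lee_fin; lra.
Qed.

Lemma sample_complexity_bound {I : finType} (v : I -> R) (Y0 Y1 : {RV P >-> R}) Ys0 Ys1
    (r E eps delta : R) :
  F Y0 -> F Y1 -> iid_copies (aux A) Y0 Ys0 -> iid_copies (aux A) Y1 Ys1 ->
  approximating A eps delta -> 0 < delta -> delta <= 1 / 4 ->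
  2 * eps < `|mean Y0 - mean Y1| ->
  injective v -> P (Y0 @^-1` (~` range v)) = 0%E -> 0 <= r ->
  (forall i, (1 + r)^-1 * fine (P (Y0 @^-1` [set v i])) <= fine (P (Y1 @^-1` [set v i]))) ->
  (expected_cost A Ys0 <= E%:E)%E ->
  ln (1 / (4 / 3 * delta)) <= 3 * r * E.
Proof.
move=> FY0 FY1 iid0 iid1 appr d0 d4 sep v_inj null r0 dom cost.
(* Chosen so that [1 - 1 / 4 - 1 / 12 = 2 / 3]. *)
have eta0 : (0 : R) < 1 / 12 by lra.
have [N massN] := accurate_at_mass FY0 iid0 appr eta0.
pose G0 := accurate_at Ys0 eps (mean Y0).
(* The samples are those of [Y1] but the target remains [mean Y0]: by separation of the means such
   outputs are wrong for [Y1]. *)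
pose G1 := accurate_at Ys1 eps (mean Y0).
have mG1 k : measurable (G1 k) by exact: measurable_accurate_at.
apply: (@stopped_mass_bound _ N (fun k => fine (P (G0 k))) r E delta) => //.
- by move=> k; exact: fine_ge0.
- by apply: le_trans massN; lra.
- by rewrite -lee_fin; apply: le_trans cost; exact: expected_cost_ge.
pose D := \big[setU/set0]_(k < N) G1 k.
have mD : measurable D by apply: bigsetU_measurable.
have disj : D `<=` ~` accurate Ys1 eps (mean Y1).
  move=> w Dw acc1; move: Dw; rewrite /D -bigcup_mkord => -[k _ /accurate_at_sub acc0].
  move: sep; rewrite ltNge => /negP; apply.
  have -> : mean Y0 - mean Y1 =
      (output A Ys1 w - mean Y1) - (output A Ys1 w - mean Y0) by ring.
  apply: le_trans (ler_normB _ _) _.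
  have := lerD acc1 acc0; rewrite /= => h; apply: le_trans h _; lra.
have PD : (P D <= delta%:E)%E.
  apply: (@le_trans _ _ (P (~` accurate Ys1 eps (mean Y1)))).
    apply: le_measure; rewrite ?inE//; apply: measurableC; exact: measurable_accurate.
  rewrite probability_setC; last exact: measurable_accurate.
  have := appr _ _ FY1 iid1; rewrite -/(accurate Ys1 eps (mean Y1)).
  rewrite -[P _]fineK ?fin_num_measure//; last exact: measurable_accurate.
  by rewrite -[1%E]/(1%:E) -EFinB !lee_fin; lra.
rewrite -lee_fin; apply: le_trans PD.
rewrite measure_bigsetU//; last exact: trivIset_accurate_at.
rewrite -sumEFin; apply: lee_sum => k _; rewrite EFinM fineK; last first.
  by apply: fin_num_measure; exact: measurable_accurate_at.
apply: (prefix_event_domination v_inj iid0 iid1) => //.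
- by rewrite invr_ge0 addr_ge0.
- exact: measurable_stopped_accurate.
- exact: prefix_stopped_accurate.
Qed.

End stopping.

(** * The two laws *)

Section root_bounds.
Context {R : realType}.

Lemma powR_root_le (S M r : R) : 0 < r -> 0 <= S -> 0 <= M ->
  S <= M `^ r -> S `^ r^-1 <= M.
Proof.
move=> r0 S0 M0 SM; rewrite -[leRHS](powRr1 M0) -(mulfV (lt0r_neq0 r0)) powRrM.
by apply: ge0_ler_powR; rewrite ?nnegrE ?invr_ge0 ?powR_ge0// ltW.
Qed.

Lemma powR_root_ge (S L r : R) : 0 < r -> 0 <= S -> 0 <= L ->
  L `^ r <= S -> L <= S `^ r^-1.
Proof.
move=> r0 S0 L0 LS; rewrite -[leLHS](powRr1 L0) -(mulfV (lt0r_neq0 r0)) powRrM.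
by apply: ge0_ler_powR; rewrite ?nnegrE ?invr_ge0 ?powR_ge0// ltW.
Qed.

End root_bounds.

Section discrete_law_classes.
Context {d} {T : measurableType d} {R : realType} (P : probability T R).
Variables (n : nat) (w x : nat -> R) (w_ge0 : forall i, 0 <= w i).

(** One threshold serves both classes: the [q]-norm is at most [tau], which is at most [K] times the
    [p]-norm. *)
Lemma discrete_law_class (Y : {RV P >-> R}) (p q K tau : R) :
  has_discrete_law n x w_ge0 Y -> 0 < p -> 0 < q -> 0 < K -> 0 <= tau ->
  \sum_(i < n) w i * `|x i - mean Y| `^ q <= tau `^ q ->
  (tau / K) `^ p <= \sum_(i < n) w i * `|x i - mean Y| `^ p ->
  (cone_class P p q K `&` central_ball P tau q) Y.
Proof.
move=> law p0 q0 K0 tau0 qle pge.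
have S0 s : 0 <= \sum_(i < n) w i * `|x i - mean Y| `^ s.
  by apply: sumr_ge0 => i _; rewrite mulr_ge0 ?powR_ge0.
have qball : (central_norm q Y <= tau%:E)%E.
  by rewrite (central_norm_discrete_law law)// lee_fin powR_root_le.
have Lq := discrete_law_Lfun law q0.
split; split => //=; apply: le_trans qball _.
rewrite (central_norm_discrete_law law)// -EFinM lee_fin -ler_pdivrMl// mulrC.
by rewrite powR_root_ge// divr_ge0// ltW.
Qed.

Lemma prob_discrete_law (Y : {RV P >-> R}) (B : set R) :
  has_discrete_law n x w_ge0 Y -> measurable B ->
  P (Y @^-1` B) = (\sum_(i < n) w i * \1_B (x i))%:E.
Proof.
move=> law mB; rewrite -[LHS]/(distribution P Y B) law// discrete_measureE.
by rewrite -sumEFin; apply: eq_bigr => i _; rewrite EFinM diracE indicE.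
Qed.

End discrete_law_classes.

(** The bounds on [a + 3 * eps] and [a - 3 * eps] place the law of [Y0] in the class, the next two
    inequalities that of [Y1]; the identity expresses the rate through [r = 3 * eps / h]. *)
Lemma spike_parameters {R : realType} (q K tau eps : R) :
  1 < q -> 1 < K -> 0 < tau -> 0 < eps -> eps <= 1 / 6 * (1 - 1 / K) * tau ->
  exists a h : R, [/\ a + 3 * eps <= tau, tau / K <= a - 3 * eps & 0 < h] /\
   [/\ a `^ q + 3 * eps / h * h `^ q <= tau `^ q,
      tau / K * (1 + 3 * eps / h) <= a &
      ((1 - 1 / K) / 6) `^ (1 / (q - 1)) * (tau / eps) `^ (1 + 1 / (q - 1)) =
      3 / (3 * eps / h)].
Proof.
move=> q1 K1 tau0 eps0.
have K0 : 0 < K by lra.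
have q0 : 0 < q by lra.
have -> : tau / K = tau * (1 - (1 - 1 / K)) by field; rewrite gt_eqF.
have : 1 - 1 / K < 1 by rewrite ltrBlDr ltrDl divr_gt0.
have : 0 < 1 - 1 / K by rewrite subr_gt0 div1r invf_lt1.
move: (1 - 1 / K) => kappa k0 k1 eps_le.
(* The upper bound on [eps] says exactly that [u >= 1], whence [tau <= h] below. *)
set u := kappa * tau / (6 * eps).
have u1 : 1 <= u by rewrite /u ler_pdivlMr; lra.
have u0 : 0 < u by exact: lt_le_trans u1.
have kt : kappa * tau < tau by rewrite gtr_pMl.
have q10 : q - 1 != 0 by rewrite gt_eqF// subr_gt0.
(* [h] makes the spike moment [3 * eps * h `^ (q - 1)] equal to the room
   [tau `^ q * (kappa / 2)] that this choice of [a] leaves below [tau `^ q]. *)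
pose h := tau * u `^ (1 / (q - 1)).
exists (tau * (1 - kappa / 2)), h.
have tau_h : tau <= h.
  apply: ler_peMr; first exact: ltW.
  have s0 : 0 <= 1 / (q - 1) by rewrite divr_ge0// subr_ge0 ltW.
  by have := ler_powR u1 s0; rewrite powRr0.
have h0 : 0 < h by exact: lt_le_trans tau_h.
have r_le : 3 * eps / h <= kappa / 2.
  rewrite ler_pdivrMr//.
  have : kappa * tau <= kappa * h by rewrite ler_pM2l.
  by lra.
have r0 : 0 < 3 * eps / h by rewrite divr_gt0// mulr_gt0.
split; split => //.
- by lra.
- by lra.
- have -> : 3 * eps / h * h `^ q = tau `^ q * (kappa / 2).
    rewrite -(mulr_powRB1 (ltW h0) q0) -(mulr_powRB1 (ltW tau0) q0) mulrA divfK ?gt_eqF//.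
    rewrite {1}/h powRM ?powR_ge0// ?ltW// -powRrM divfK// powRr1 ?ltW//.
    by rewrite /u; field; rewrite gt_eqF.
  (* As [q >= 1], the [q]-th power of [1 - kappa / 2] is at most [1 - kappa / 2]. *)
  have kk : 0 < 1 - kappa / 2 <= 1 by apply/andP; split; lra.
  rewrite powRM ?(ltW tau0)//; last by case/andP: kk => /ltW.
  rewrite -mulrDr. apply: ler_piMr; first exact: powR_ge0.
  by have := ge1r_powR kk (ltW q1); lra.
(* Here [(1 - kappa) * (1 + kappa / 2)] falls short of [1 - kappa / 2] by [kappa * kappa / 2]. *)
- rewrite -mulrA ler_pM2l//.
  have : (1 - kappa) * (1 + 3 * eps / h) <= (1 - kappa) * (1 + kappa / 2).
    by rewrite ler_wpM2l//; lra.
  have : 0 <= kappa * kappa by rewrite mulr_ge0// ltW.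
  by lra.
- have te0 : 0 < tau / eps by exact: divr_gt0.
  rewrite powRD; last by apply/implyP => _; rewrite gt_eqF.
  rewrite powRr1 ?ltW// mulrCA -powRM ?ltW//; last by rewrite divr_gt0.
  have -> : kappa / 6 * (tau / eps) = u by rewrite /u; field; rewrite gt_eqF.
  by rewrite /h; field; rewrite ?gt_eqF ?powR_gt0.
Qed.

Section two_laws.
Context {R : realType} (a g h : R).

Definition atom (i : nat) : R :=
  match i with 0%N => a | 1%N => - a | _ => h end.
(** The atom [h] is kept with weight 0, so that the two laws can be compared weight by weight. *)
Definition bulk_weight (i : nat) : R :=
  match i with 0%N => (1 - g / a) / 2 | 1%N => (1 + g / a) / 2 | _ => 0 end.
Definition spike_weight (i : nat) : R :=
  (bulk_weight i + g / h * (i == 2)%:R) / (1 + g / h).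

Hypotheses (g0 : 0 < g) (ga : g < a) (h0 : 0 < h).

Let a0 : 0 < a. Proof. exact: lt_trans ga. Qed.

Let r0 : 0 < g / h. Proof. exact: divr_gt0. Qed.

Let r1 : 0 < 1 + g / h. Proof. by rewrite addr_gt0. Qed.

Lemma bulk_weight_ge0 i : 0 <= bulk_weight i.
Proof.
have : g / a <= 1 by rewrite ler_pdivrMr// mul1r ltW.
have : 0 < g / a by exact: divr_gt0.
by case: i => [|[|i]] //=; lra.
Qed.

Lemma spike_weight_ge0 i : 0 <= spike_weight i.
Proof.
apply: divr_ge0; last exact: ltW.
by rewrite addr_ge0 ?bulk_weight_ge0// mulr_ge0// ltW.
Qed.

Lemma bulk_weight_sum : \sum_(i < 3) bulk_weight i = 1.
Proof. by rewrite !big_ord_recl big_ord0 /=; lra. Qed.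

Lemma spike_weight_sum : \sum_(i < 3) spike_weight i = 1.
Proof.
rewrite -mulr_suml big_split /= bulk_weight_sum -mulr_sumr.
by rewrite !big_ord_recl big_ord0 /= addr0 !add0r mulr1 divff// gt_eqF.
Qed.

Lemma bulk_mean : \sum_(i < 3) bulk_weight i * atom i = - g.
Proof. by rewrite !big_ord_recl big_ord0 /=; field; rewrite gt_eqF. Qed.

Lemma spike_mean : \sum_(i < 3) spike_weight i * atom i = 0.
Proof.
rewrite !big_ord_recl big_ord0 /spike_weight /=; field.
by rewrite !gt_eqF// addr_gt0.
Qed.

Context {d} {T : measurableType d} (P : probability T R) (Y : {RV P >-> R}).
Variables (p q K tau : R).
Hypotheses (p1 : 1 <= p) (q1 : 1 < q) (K1 : 1 < K) (tau0 : 0 < tau).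

Let p0 : 0 < p. Proof. exact: lt_le_trans p1. Qed.

Let q0 : 0 < q. Proof. exact: lt_trans q1. Qed.

Let K0 : 0 < K. Proof. exact: lt_trans K1. Qed.

Let powR_mono (s x y : R) : 0 < s -> 0 <= x -> x <= y -> x `^ s <= y `^ s.
Proof.
move=> s0 x0 xy; apply: ge0_ler_powR; rewrite ?nnegrE ?(ltW s0)//.
exact: le_trans xy.
Qed.

(** Around the mean [- g] the atoms of positive weight deviate by [a + g] and [a - g], both between
    [tau / K] and [tau], so pointwise bounds give both moment bounds. *)
Lemma bulk_law_class : a + g <= tau -> tau / K <= a - g ->
  has_discrete_law 3 atom bulk_weight_ge0 Y ->
  (cone_class P p q K `&` central_ball P tau q) Y.
Proof.
move=> a_le a_ge law.
have dev (i : 'I_3) : 0 < bulk_weight i ->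
    tau / K <= `|atom i - mean Y| /\ `|atom i - mean Y| <= tau.
  have [? ?] : 0 < g /\ g < a by [].
  rewrite (mean_discrete_law law) bulk_mean opprK.
  case: i => [[|[|[|i]]] //= _]; rewrite ?ltxx// => _.
    by rewrite ger0_norm; [split; lra|lra].
  by rewrite addrC distrC ger0_norm; [split; lra|lra].
apply: discrete_law_class law _ _ _ _ _ _ => //; first exact: ltW.
- rewrite -[leRHS]mul1r -bulk_weight_sum mulr_suml; apply: ler_sum => i _.
  have := bulk_weight_ge0 i; rewrite le_eqVlt => /predU1P[<-|wi]; first by rewrite !mul0r.
  by rewrite ler_pM2l//; apply: powR_mono => //; have [] := dev i wi.
- rewrite -[leLHS]mul1r -bulk_weight_sum mulr_suml; apply: ler_sum => i _.
  have := bulk_weight_ge0 i; rewrite le_eqVlt => /predU1P[<-|wi]; first by rewrite !mul0r.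
  rewrite ler_pM2l//; apply: powR_mono => //; last by have [] := dev i wi.
  by rewrite divr_ge0 ?ltW.
Qed.

(** For exponent [q] the division by [1 + g / h] is dropped. For exponent [p] the spike term is
    dropped, and [p >= 1] bounds [(1 + g / h)^-1] below by its [p]-th power. *)
Lemma spike_law_class :
  a `^ q + g / h * h `^ q <= tau `^ q -> tau / K * (1 + g / h) <= a ->
  has_discrete_law 3 atom spike_weight_ge0 Y ->
  (cone_class P p q K `&` central_ball P tau q) Y.
Proof.
move=> q_le p_ge law.
have SE s : \sum_(i < 3) spike_weight i * `|atom i - mean Y| `^ s =
    (a `^ s + g / h * h `^ s) / (1 + g / h).
  rewrite (mean_discrete_law law) spike_mean.
  rewrite !big_ord_recl big_ord0 /spike_weight /= !subr0 normrN !gtr0_norm//.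
  by field; rewrite !gt_eqF// addr_gt0.
apply: discrete_law_class law _ _ _ _ _ _ => //; first exact: ltW.
- rewrite SE ler_pdivrMr//; apply: le_trans q_le _.
  by apply: ler_peMr; rewrite ?powR_ge0// lerDl ltW.
- rewrite SE.
  apply: (@le_trans _ _ (a `^ p / (1 + g / h))); last first.
    by rewrite ler_pM2r ?invr_gt0// lerDl mulr_ge0 ?powR_ge0// ltW.
  apply: (@le_trans _ _ ((a / (1 + g / h)) `^ p)).
    apply: powR_mono => //; last by rewrite ler_pdivlMr.
    by rewrite divr_ge0 ?ltW.
  rewrite powRM ?invr_ge0 ?(ltW a0) ?(ltW r1)// ler_pM2l ?powR_gt0// ge1r_powR//.
  by rewrite invr_gt0 r1 invf_le1// lerDl ltW.
Qed.

End two_laws.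

(** * The lower bound for an arbitrary algorithm *)

Theorem theorem3p10 (R : realType) (q K : R) (hq1 : 1 < q) (hq2 : q <= 2)
    (hK : 1 < K) :
  exists c : R, 0 < c /\
  forall (d : measure_display) (T : measurableType d) (P : probability T R)
    (p tau eps delta : R),
    carries_all_laws P ->
    1 <= p -> p < q -> 0 < tau ->
    0 < eps -> eps <= 1 / 6 * (1 - 1 / K) * tau ->
    0 < delta -> delta <= 1 / 4 ->
    ((c * ((tau / eps) `^ (1 + 1 / (q - 1))) *
      ln (1 / (4 / 3 * delta)))%:E <=
     worst_case_complexity eps delta
       (cone_class P p q K `&` central_ball P tau q))%E.
Proof.
(* By [spike_parameters] the last factor times the power of [tau / eps] is [3 / r], and [1 / 9]
   turns it into the [1 / (3 * r)] of [sample_complexity_bound]. *)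
exists (1 / 9 * ((1 - 1 / K) / 6) `^ (1 / (q - 1))); split.
  rewrite mulr_gt0// powR_gt0// divr_gt0// subr_gt0 div1r invf_lt1//.
  exact: lt_trans hK.
move=> d T P p tau eps delta carries p1 pq tau0 eps0 eps_le delta0 delta_le.
have [a [h [[a_le a_ge h0] [q_le p_ge scale]]]] :=
  spike_parameters hq1 hK tau0 eps0 eps_le.
rewrite -(mulrA (1 / 9)) scale.
have g0 : 0 < 3 * eps by rewrite mulr_gt0.
have ga : 3 * eps < a.
  by rewrite -subr_gt0; apply: lt_le_trans a_ge; rewrite divr_gt0// (lt_trans ltr01).
have r0 : 0 < 3 * eps / h by exact: divr_gt0.
have [Y0 law0] :=
  exists_discrete_law (atom a h) (bulk_weight_ge0 g0 ga) carries (bulk_weight_sum _ _).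
have [Y1 law1] :=
  exists_discrete_law (atom a h) (spike_weight_ge0 g0 ga h0) carries (spike_weight_sum a g0 h0).
have mean0 : mean Y0 = - (3 * eps) by rewrite (mean_discrete_law law0) bulk_mean.
have mean1 : mean Y1 = 0 by rewrite (mean_discrete_law law1) spike_mean.
have F0 := bulk_law_class p1 hq1 hK tau0 a_le a_ge law0.
have F1 := spike_law_class p1 hq1 hK tau0 q_le p_ge law1.
(* The alphabet omits the spike [h]: words only need to describe samples of [Y0]. *)
pose v (b : bool) := if b then a else - a.
have v_inj : injective v.
  by move=> [] [] //=; rewrite /v; lra.
have mrange : measurable (range v).
  have -> : range v = [set a] `|` [set - a].
    apply/seteqP; split => [_ [[] _ <-]|_ [->|->]]; [by left|by right|by exists true|by exists false].
  exact: measurableU.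
have null : P (Y0 @^-1` (~` range v)) = 0%E.
  rewrite (prob_discrete_law law0); last exact: measurableC.
  rewrite !big_ord_recl big_ord0 /= mul0r !indicE !memNset ?mulr0 ?addr0//=.
  - by apply; exists false.
  - by apply; exists true.
have dom b : (1 + 3 * eps / h)^-1 * fine (P (Y0 @^-1` [set v b])) <=
    fine (P (Y1 @^-1` [set v b])).
  rewrite (prob_discrete_law law0)// (prob_discrete_law law1)//= mulr_sumr.
  apply: ler_sum => i _; rewrite mulrA ler_wpM2r// mulrC ler_pM2r ?invr_gt0 ?addr_gt0//.
  by rewrite lerDl mulr_ge0// ltW.
apply: le_ereal_inf_tmp => _ [n [n0 [A [appr cost]]] <-].
have [Ys0 iid0] := aux_leaves_room A F0.
have [Ys1 iid1] := aux_leaves_room A F1.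
have cost0 : (expected_cost A Ys0 <= n%:E)%E.
  by apply: le_trans cost; apply: ereal_sup_ubound; exists Ys0 => //; exists Y0.
have sep : 2 * eps < `|mean Y0 - mean Y1|.
  by rewrite mean0 mean1 subr0 normrN gtr0_norm//; lra.
have bound := sample_complexity_bound F0 F1 iid0 iid1 appr delta0 delta_le sep
  v_inj null (ltW r0) dom cost0.
rewrite lee_fin (_ : 1 / 9 * (3 / (3 * eps / h)) = (3 * (3 * eps / h))^-1); last first.
  by field; rewrite !gt_eqF.
by rewrite ler_pdivrMl// mulr_gt0.
Qed.
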